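(* (1) Intuitionistic predicate logic is strongly complete with respect to sheaf-valued structures with countable domain over the Baire space $\mathbb N^{\mathbb N}$: for formulas $\phi_1,\dots,\phi_k,\psi$, if $\psi$ is valid in every sheaf-valued structure over $\mathbb N^{\mathbb N}$ with countable domain in which $\phi_1,\dots,\phi_k$ are all valid, then $\psi$ is derivable from $\phi_1,\dots,\phi_k$ in intuitionistic predicate logic. (2) For any given zero-dimensional separable metrizable space $X$ with no isolated points, intuitionistic predicate logic is complete with respect to sheaf-valued structures with countable domain over $X$: every formula valid in all sheaf-valued structures over $X$ with countable domain is a theorem of intuitionistic predicate logic.
   Context: Language: first-order language with individual variables, countably many predicate variables of each arity, no function symbols or constants, connectives $\bot,\land,\lor,\to,\exists,\forall$; $\neg\alpha:=\alpha\to\bot$. Derivability from hypotheses is in Heyting's intuitionistic predicate calculus, with modus ponens and the generalization rule $\alpha(x)/\forall x\,\alpha(x)$ allowed also on variables free in hypotheses. A sheaf on a space $B$ is a local homeomorphism $\mathcal F\colon E\to B$; a section over open $U$ is a continuous $s\colon U\to E$ with $\mathcal Fs=\mathrm{id}_U$. For sheaves $\mathcal F_i$: $\bigsqcup\mathcal F_i$ is the disjoint union of total spaces, $\prod\mathcal F_i$ is the sheafification of the presheaf $U\mapsto\prod_i\{\text{sections of }\mathcal F_i\text{ over }U\}$, $\mathrm{Hom}(\mathcal F,\mathcal G)$ is the sheafification of the presheaf assigning to $U$ the set of sheaf morphisms $\mathcal F|_U\to\mathcal G|_U$, and $\chi_\emptyset$ is the empty sheaf. A sheaf-valued structure over $B$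 with domain $D$ assigns a sheaf $|P|(d_1,\dots,d_n)$ on $B$ to each $n$-ary predicate variable $P$ and each tuple in $D^n$; formulas are interpreted under a valuation $\mu$ by $|\alpha\lor\beta|=|\alpha|\sqcup|\beta|$, $|\alpha\land\beta|=|\alpha|\times|\beta|$, $|\alpha\to\beta|=\mathrm{Hom}(|\alpha|,|\beta|)$, $|\bot|=\chi_\emptyset$, $|\exists x\,\alpha|_\mu=\bigsqcup_{d\in D}|\alpha|_{\mu[x\mapsto d]}$, $|\forall x\,\alpha|_\mu=\prod_{d\in D}|\alpha|_{\mu[x\mapsto d]}$. A formula $\phi$ is valid in the structure if $|\phi|_\mu$ has a global section for every valuation $\mu$. *)

(* Defs.v *)
From HB Require Import structures.
From mathcomp Require Import all_boot all_order all_algebra.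
From mathcomp Require Import all_classical all_reals topology.

Set Implicit Arguments.
Unset Strict Implicit.
Unset Printing Implicit Defensive.

Import Order.TTheory GRing.Theory Num.Theory.
Local Open Scope classical_set_scope.

(* Individual variables are natural numbers. [Atom n i xs] is the i-th
   n-ary predicate variable applied to the individual variables xs. *)
Inductive formula : Type :=
| Bot
| Atom (n i : nat) (xs : n.-tuple nat)
| And (a b : formula)
| Or (a b : formula)
| Imp (a b : formula)
| Ex (x : nat) (a : formula)
| All (x : nat) (a : formula).

Fixpoint is_free (x : nat) (a : formula) : bool :=
  match a with
  | Bot => false
  | Atom _ _ xs => x \in xs
  | And a b | Or a b | Imp a b => is_free x a || is_free x b
  | Ex z a | All z a => (z != x) && is_free x a
  end.

(* [subst x y a] replaces the free occurrences of x in a by y, without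
   renaming bound variables; it is only meaningful under [free_for x y a]. *)
Fixpoint subst (x y : nat) (a : formula) : formula :=
  match a with
  | Bot => Bot
  | Atom n i xs => Atom i (map_tuple (fun z => if z == x then y else z) xs)
  | And a b => And (subst x y a) (subst x y b)
  | Or a b => Or (subst x y a) (subst x y b)
  | Imp a b => Imp (subst x y a) (subst x y b)
  | Ex z a => if z == x then Ex z a else Ex z (subst x y a)
  | All z a => if z == x then All z a else All z (subst x y a)
  end.

(* y is free for x in a: no free occurrence of x lies in the scope of a
   quantifier binding y. *)
Fixpoint free_for (x y : nat) (a : formula) : bool :=
  match a with
  | Bot | Atom _ _ _ => true
  | And a b | Or a b | Imp a b => free_for x y a && free_for x y b
  | Ex z a | All z a =>
      ~~ ((z != x) && is_free x a) || ((z != y) && free_for x y a)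
  end.

(* [der_gen] carries no side condition on the hypotheses G. *)
Inductive derivable (G : set formula) : formula -> Prop :=
| der_hyp a : G a -> derivable G a
| der_K a b : derivable G (Imp a (Imp b a))
| der_S a b c :
    derivable G (Imp (Imp a (Imp b c)) (Imp (Imp a b) (Imp a c)))
| der_andI a b : derivable G (Imp a (Imp b (And a b)))
| der_andE1 a b : derivable G (Imp (And a b) a)
| der_andE2 a b : derivable G (Imp (And a b) b)
| der_orI1 a b : derivable G (Imp a (Or a b))
| der_orI2 a b : derivable G (Imp b (Or a b))
| der_orE a b c :
    derivable G (Imp (Imp a c) (Imp (Imp b c) (Imp (Or a b) c)))
| der_botE a : derivable G (Imp Bot a)
| der_allE x y a : free_for x y a -> derivable G (Imp (All x a) (subst x y a))
| der_exI x y a : free_for x y a -> derivable G (Imp (subst x y a) (Ex x a))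
| der_allI x a b : ~~ is_free x b ->
    derivable G (Imp (All x (Imp b a)) (Imp b (All x a)))
| der_exE x a b : ~~ is_free x b ->
    derivable G (Imp (All x (Imp a b)) (Imp (Ex x a) b))
| der_mp a b : derivable G a -> derivable G (Imp a b) -> derivable G b
| der_gen x a : derivable G a -> derivable G (All x a).

(* g is the inverse of the homeomorphism p : A -> p(A). *)
Definition local_homeomorphism (E B : topologicalType) (p : E -> B) :=
  forall e : E, exists (A : set E) (g : B -> E),
    [/\ open A /\ A e, open (p @` A),
        {within A, continuous p}, {within p @` A, continuous g} &
        forall a, A a -> g (p a) = a].

Record sheaf (B : topologicalType) := Sheaf {
  total :> topologicalType;
  proj_sh : total -> B;
  proj_sh_lh : local_homeomorphism proj_sh }.

Section sections.
Variable B : topologicalType.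

(* Sections live on the subspace U itself (coerced to a type), so that equal
   sections are equal elements of this type. *)
Record sections (F : sheaf B) (U : set B) := Sections {
  sec_fun :> U -> F;
  sec_continuous : continuous sec_fun;
  sec_proj : forall x : U, proj_sh (sec_fun x) = val x }.

Lemma sections_eq (F : sheaf B) (U : set B) (s t : sections F U) :
  (forall x, s x = t x) -> s = t.
Proof.
case: s t => [s cs ps] [t ct pt] /= /funext st; subst t.
by congr Sections; exact: Prop_irrelevance.
Qed.

Definition has_global_section (F : sheaf B) := inhabited (sections F [set: B]).

End sections.

Definition incl (T : Type) (U V : set T) (VU : V `<=` U) (x : V) : U :=
  exist _ (val x) (mem_set (VU _ (set_mem (valP x)))).

Lemma val_incl (T : Type) (U V : set T) (VU : V `<=` U) (x : V) :
  val (incl VU x) = val x.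
Proof. by []. Qed.

Lemma incl_continuous (T : topologicalType) (U V : set T) (VU : V `<=` U) :
  continuous (incl VU).
Proof.
apply/continuousP => _ [A oA <-].
by exists A => //; apply/seteqP; split.
Qed.

Record opens (B : topologicalType) := Opens {
  open_set :> set B;
  open_setP : open open_set }.

Record presheaf (B : topologicalType) := Presheaf {
  psec : opens B -> Type;
  pres : forall U V : opens B, V `<=` U -> psec U -> psec V;
  pres_id : forall (U : opens B) (UU : U `<=` U) (s : psec U), pres UU s = s;
  pres_comp : forall (U V W : opens B) (VU : V `<=` U) (WV : W `<=` V)
    (WU : W `<=` U) (s : psec U), pres WV (pres VU s) = pres WU s }.

Section sheafification.
Variables (B : topologicalType) (P : presheaf B).

Definition same_germ (b : B) (s t : {U : opens B & psec P U}) : Prop :=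
  exists (W : opens B) (WU : W `<=` projT1 s) (WV : W `<=` projT1 t),
    open_set W b /\ pres WU (projT2 s) = pres WV (projT2 t).

Lemma same_germ_refl b s : open_set (projT1 s) b -> same_germ b s s.
Proof.
by case: s => U s Ub; exists U, (fun _ h => h), (fun _ h => h); split.
Qed.

Lemma same_germ_sym b s t : same_germ b s t -> same_germ b t s.
Proof. by move=> [W [WU [WV [Wb st]]]]; exists W, WV, WU. Qed.

Lemma same_germ_trans b s t u :
  same_germ b s t -> same_germ b t u -> same_germ b s u.
Proof.
move=> [W [WU [WV [Wb st]]]] [W' [W'V [W'Z [W'b tu]]]].
pose O := Opens (openI (open_setP W) (open_setP W')).
have OW : O `<=` W by move=> x [].
have OW' : O `<=` W' by move=> x [].
exists O, (subset_trans OW WU), (subset_trans OW' W'Z); split=> //.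
rewrite -(pres_comp WU OW) st (pres_comp WV OW (subset_trans OW WV)).
by rewrite -(pres_comp W'Z OW') -tu (pres_comp W'V OW' (subset_trans OW WV)).
Qed.

(* A germ at [germ_pt] is an equivalence class of local sections. *)
Record etale := Etale {
  germ_pt : B;
  germ_class : set {U : opens B & psec P U};
  germ_classP : exists2 s : {U : opens B & psec P U},
    open_set (projT1 s) germ_pt & germ_class = [set t | same_germ germ_pt s t] }.

HB.instance Definition _ := gen_eqMixin etale.
HB.instance Definition _ := gen_choiceMixin etale.

Definition germ (U : opens B) (s : psec P U) (b : B) (Ub : open_set U b) : etale :=
  Etale (ex_intro2 _ _ (existT _ U s) Ub erefl).

Definition germs (U : opens B) (s : psec P U) : set etale :=
  [set e | exists b (Ub : open_set U b), germ s Ub = e].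

Definition etale_base : set (set etale) :=
  [set A | exists (U : opens B) (s : psec P U), A = germs s].

Lemma etale_eq (e f : etale) :
  germ_pt e = germ_pt f -> germ_class e = germ_class f -> e = f.
Proof.
case: e f => [b c p] [b' c' p'] /= bb cc; subst b' c'.
by congr Etale; exact: Prop_irrelevance.
Qed.

Lemma germP U (s : psec P U) V (t : psec P V) b (Ub : open_set U b) (Vb : open_set V b) :
  germ s Ub = germ t Vb <->
  same_germ b (existT _ U s) (existT _ V t).
Proof.
split=> [[st]|st].
  apply: same_germ_sym.
  have /= <- := congr1 (fun A : set _ => A (existT _ U s)) st.
  exact: same_germ_refl.
apply: etale_eq => //=; apply/seteqP; split => u /=; last exact: same_germ_trans.
by move=> su; apply: same_germ_trans su; exact: same_germ_sym.
Qed.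

Lemma etaleP (e : etale) :
  exists (U : opens B) (s : psec P U) (Ub : open_set U (germ_pt e)),
    e = germ s Ub.
Proof.
have [[U s] Ub ec] := germ_classP e.
by exists U, s, Ub; apply: etale_eq.
Qed.

Lemma etale_base_cover : \bigcup_(A in etale_base) A = [set: etale].
Proof.
apply/seteqP; split=> // e _.
have [U [s [Ub ee]]] := etaleP e.
exists (germs s); first by exists U, s.
by exists (germ_pt e), Ub.
Qed.

Lemma etale_base_join (A A' : set etale) (e : etale) :
  etale_base A -> etale_base A' -> A e -> A' e ->
  exists C, [/\ etale_base C, C e & C `<=` A `&` A'].
Proof.
move=> [U [s ->]] [V [t ->]] [b [Ub <-]] [b' [Vb' E]].
have bb : b' = b by have := congr1 germ_pt E.
subst b'; have [W [WV [WU [Wb st]]]] := (germP t s Vb' Ub).1 E.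
rewrite /= in WV WU st.
have in_s c (Wc : open_set W c) : germ (pres WU s) Wc = germ s (WU _ Wc).
  apply/germP; exists W, (fun _ h => h), WU; split=> //=.
  by rewrite (pres_id (fun _ h => h)).
have in_t c (Wc : open_set W c) : germ (pres WU s) Wc = germ t (WV _ Wc).
  apply/germP; exists W, (fun _ h => h), WV; split=> //=.
  by rewrite (pres_id (fun _ h => h)).
exists (germs (pres WU s)); split; first by exists W, (pres WU s).
  by exists b, Wb; rewrite in_s; apply: etale_eq.
move=> _ [c [Wc <-]]; split; first by exists c, (WU _ Wc); rewrite in_s.
by exists c, (WV _ Wc); rewrite in_t.
Qed.

HB.instance Definition _ := @isBaseTopological.Build etale
  (set etale) etale_base id etale_base_cover
  (fun A A' e a a' => @etale_base_join A A' e a a').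

Lemma germs_open U (s : psec P U) : open (germs s).
Proof.
exists [set germs s]; first by move=> _ ->; exists U, s.
by rewrite bigcup_set1.
Qed.

Lemma germ_pt_continuous : continuous germ_pt.
Proof.
apply/continuousP => A oA.
rewrite openE => e Ae; rewrite /interior nbhsE /=.
have [U [s [Ub ee]]] := etaleP e.
pose O := Opens (openI (open_setP U) oA).
have OU : O `<=` U by move=> x [].
exists (germs (pres OU s)); last by move=> _ [b [[Ub' Ab] <-]].
split; first exact: germs_open.
have Oe : open_set O (germ_pt e) by split.
exists (germ_pt e), Oe; rewrite [RHS]ee; apply/germP.
exists O, (fun _ h => h), OU; split=> //=.
by rewrite (pres_id (fun _ h => h)).
Qed.

Lemma germ_pt_lh : local_homeomorphism germ_pt.
Proof.
move=> e; have [U [s [Ub ee]]] := etaleP e.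
pose g (b : B) : etale :=
  if pselect (open_set U b) is left Ub then germ s Ub else e.
have gE b (h : open_set U b) : g b = germ s h.
  by rewrite /g; case: pselect => // h'; congr germ; exact: Prop_irrelevance.
have imE : germ_pt @` germs s = open_set U.
  apply/seteqP; split=> [_ [_ [b [h <-]] <-]//|b h].
  by exists (germ s h) => //; exists b, h.
exists (germs s), g; rewrite imE; split.
- split; first exact: germs_open.
  by exists (germ_pt e), Ub.
- exact: open_setP.
- exact/continuous_subspaceT/germ_pt_continuous.
- rewrite continuous_open_subspace; last exact: open_setP.
  move=> b /set_mem Hb A /=; rewrite gE nbhsE => -[O [oO Ob] OA].
  case: oO => D Dsub OE; rewrite -OE in Ob OA; case: Ob => C DC Cb.
  have [V [t Ct]] := Dsub _ DC; rewrite /= Ct in Cb.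
  have [b' [Vb' E]] := Cb.
  have bb : b' = b by have := congr1 germ_pt E.
  subst b'; have [W [WV [WU [Wb st]]]] := (germP t s Vb' Hb).1 E.
  rewrite /= in WV WU st.
  rewrite nbhsE /=; exists W; first by split=> //; exact: open_setP.
  move=> c Wc /=; rewrite (gE _ (WU _ Wc)); apply: OA.
  exists C => //=; rewrite Ct; exists c, (WV _ Wc).
  by apply/germP; exists W, WV, WU.
- by move=> _ [b [h <-]] /=; rewrite (gE _ h).
Qed.

Definition sheafification : sheaf B := Sheaf germ_pt_lh.

End sheafification.

Section operations.
Variable B : topologicalType.

Section family.
Variables (I : choiceType) (F : I -> sheaf B).

Definition coprod_proj (e : {i : I & F i}) : B := proj_sh (projT2 e).

Lemma coprod_lh : local_homeomorphism coprod_proj.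
Proof.
case=> i e; have [A [g [[oA Ae] opA cp cg pgK]]] := @proj_sh_lh _ (F i) e.
have imE : coprod_proj @` (existT _ i @` A) = @proj_sh _ (F i) @` A.
  apply/seteqP; split=> [_ [_ [a Aa <-] <-]|_ [a Aa <-]]; first by exists a.
  by exists (existT _ i a) => //; exists a.
have oA' : open (existT (fun j => F j : topologicalType) i @` A).
  exact: existT_open_map.
exists (existT (fun j => F j : topologicalType) i @` A), (existT _ i \o g).
rewrite imE; split => //.
- rewrite continuous_open_subspace // => _ /set_mem [a Aa <-] U nU.
  rewrite continuous_open_subspace // in cp.
  exact: (cp a (mem_set Aa) U nU).
- rewrite continuous_open_subspace // => b bA.
  rewrite continuous_open_subspace // in cg.
  apply: continuous_comp; first exact: cg.
  exact: existT_continuous.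
- by move=> _ [a Aa <-] /=; rewrite /coprod_proj /= pgK.
Qed.

Definition sheaf_coprod : sheaf B := Sheaf coprod_lh.

Definition prod_res (U V : opens B) (VU : V `<=` U)
    (s : forall i, sections (F i) U) (i : I) : sections (F i) V.
Proof.
refine (@Sections _ _ _ (fun x => s i (incl VU x)) _ _).
- move=> x; apply: (@continuous_comp _ _ _ (incl VU) (s i)).
    exact: incl_continuous.
  exact: sec_continuous.
- by move=> x; rewrite sec_proj val_incl.
Defined.

Definition prod_presheaf : presheaf B.
Proof.
refine (@Presheaf B (fun U => forall i, sections (F i) U) prod_res _ _).
- move=> U UU s; apply: functional_extensionality_dep => i.
  by apply: sections_eq => x /=; congr (s i _); exact: val_inj.
- move=> U V W VU WV WU s; apply: functional_extensionality_dep => i.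
  by apply: sections_eq => x /=; congr (s i _); exact: val_inj.
Defined.

Definition sheaf_prod : sheaf B := sheafification prod_presheaf.

End family.

Section hom.
Variables F G : sheaf B.

(* A morphism F|_U -> G|_U: its domain is the part of F over U, and
   [mor_proj] forces its image into the part of G over U. *)
Record morphisms (U : set B) := Morphisms {
  mor_fun :> (@proj_sh _ F @^-1` U) -> G;
  mor_continuous : continuous mor_fun;
  mor_proj : forall e, proj_sh (mor_fun e) = proj_sh (val e) }.

Lemma morphisms_eq (U : set B) (f g : morphisms U) :
  (forall x, f x = g x) -> f = g.
Proof.
case: f g => [f cf pf] [g cg pg] /= /funext fg; subst g.
by congr Morphisms; exact: Prop_irrelevance.
Qed.

Definition hom_res (U V : opens B) (VU : V `<=` U) (f : morphisms U) :
  morphisms V.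
Proof.
pose VU' := preimage_subset VU (f := @proj_sh _ F).
refine (@Morphisms V (fun x => f (incl VU' x)) _ _).
- move=> x; apply: (@continuous_comp _ _ _ (incl VU') f).
    exact: incl_continuous.
  exact: mor_continuous.
- by move=> x; rewrite mor_proj val_incl.
Defined.

Definition hom_presheaf : presheaf B.
Proof.
refine (@Presheaf B morphisms hom_res _ _).
- by move=> U UU f; apply: morphisms_eq => x /=; congr (mor_fun f _); exact: val_inj.
- move=> U V W VU WV WU f.
  by apply: morphisms_eq => x /=; congr (mor_fun f _); exact: val_inj.
Defined.

Definition sheaf_hom : sheaf B := sheafification hom_presheaf.

End hom.

Lemma empty_lh :
  local_homeomorphism (fun e : discrete_topology void => of_void B e).
Proof. by case. Qed.

Definition sheaf_empty : sheaf B := Sheaf empty_lh.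

Definition sheaf_pair (F G : sheaf B) (i : bool) : sheaf B :=
  if i then F else G.

End operations.

(* [M n i ds] is the sheaf assigned to the i-th n-ary predicate variable and
   the tuple ds. *)
Definition sheaf_structure (B : topologicalType) (D : Type) :=
  forall n : nat, nat -> n.-tuple D -> sheaf B.

Definition update (D : Type) (mu : nat -> D) (x : nat) (d : D) : nat -> D :=
  fun z => if z == x then d else mu z.

Fixpoint interp (B : topologicalType) (D : choiceType)
    (M : sheaf_structure B D) (a : formula) (mu : nat -> D) : sheaf B :=
  match a with
  | Bot => sheaf_empty B
  | Atom n i xs => M n i (map_tuple mu xs)
  | And a b => sheaf_prod (sheaf_pair (interp M a mu) (interp M b mu))
  | Or a b => sheaf_coprod (sheaf_pair (interp M a mu) (interp M b mu))
  | Imp a b => sheaf_hom (interp M a mu) (interp M b mu)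
  | Ex x a => sheaf_coprod (fun d : D => interp M a (update mu x d))
  | All x a => sheaf_prod (fun d : D => interp M a (update mu x d))
  end.

Definition valid (B : topologicalType) (D : choiceType)
    (M : sheaf_structure B D) (a : formula) : Prop :=
  forall mu : nat -> D, has_global_section (interp M a mu).

Definition baire_space : topologicalType := prod_topology (fun _ : nat => nat).

Definition separable (X : topologicalType) : Prop :=
  exists2 A : set X, countable A & dense A.

Definition metrizable (R : realType) (X : topologicalType) : Prop :=
  exists d : X -> X -> R,
    [/\ forall x y, (0 <= d x y)%R,
        forall x y, d x y = 0%R <-> x = y,
        forall x y, d x y = d y x,
        forall x y z, (d x z <= d x y + d y z)%R &
        forall (x : X) (A : set X), nbhs x A <->
          exists2 e : R, (0 < e)%R & [set y | (d x y < e)%R] `<=` A].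

(* Small inductive dimension <= 0. The library's [zero_dimensional] only asks
   clopen sets to separate points, which is strictly weaker, even for separable
   metrizable spaces. *)
Definition clopen_base (X : topologicalType) : Prop :=
  basis [set U : set X | clopen U].

(* Main.v *)
(* On a space with a countable base of clopen sets every sheaf has a section over
   each open part of its support, since an open cover can be made disjoint.
   Hence taking supports carries the sheaf interpretation to the interpretation
   in the Heyting algebra of open sets, and validity means full support.

   Both parts then follow from strong completeness of the open-set semantics over
   any nonempty perfect T1 space with a countable clopen base. Suppose [psi] is
   not derivable from [G]. Points are given theories by refining clopen pieces:
   a piece [V] carries a formula [t] forced on it, a point [p] of [V], and a
   formula [c] not derivable from [t], to be omitted at [p]. At each stage [V]
   is split into a neighbourhood of [p] and a nonempty rest; the rest is used to
   refute an implication [a -> c'] not derivable from [t], by adding [a] to [t]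
   and omitting [c'] at a new point, while disjunctions and existential formulas
   entailed by [t] receive a disjunct or a witness. The formulas forced on some
   piece around [x] form a prime saturated theory of [x], and membership in it
   is truth at [x].

   The individuals are the variables [d + N], where [N] exceeds every variable of
   [G] and [psi], so that instantiation never captures a variable. *)

Require Import Defs.
From HB Require Import structures.
From mathcomp Require Import all_boot all_order all_algebra.
From mathcomp Require Import all_classical all_reals topology.

Set Implicit Arguments.
Unset Strict Implicit.
Unset Printing Implicit Defensive.

Local Open Scope classical_set_scope.

(** * Formulas *)

(** Bound variables count too, so a variable [y] with [vbound a <= y] does not occur in [a] at
    all. *)
Fixpoint vbound (a : formula) : nat :=
  match a with
  | Bot => 0
  | Atom _ _ xs => (\max_(x <- xs) x.+1)%N
  | And a b | Or a b | Imp a b => maxn (vbound a) (vbound b)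
  | Ex z a | All z a => maxn z.+1 (vbound a)
  end.

Lemma vbound_free y a : (vbound a <= y)%N -> is_free y a = false.
Proof.
elim: a => //= [n i xs|a IHa b IHb|a IHa b IHb|a IHa b IHb|z a IH|z a IH].
- move=> h; apply/negP => yxs; have := @leq_bigmax_seq _ (tval xs) predT succn y yxs erefl.
  by rewrite leqNgt ltnS h.
- by rewrite geq_max => /andP[/IHa -> /IHb ->].
- by rewrite geq_max => /andP[/IHa -> /IHb ->].
- by rewrite geq_max => /andP[/IHa -> /IHb ->].
- by rewrite geq_max => /andP[_ /IH ->]; rewrite andbF.
- by rewrite geq_max => /andP[_ /IH ->]; rewrite andbF.
Qed.

Lemma vbound_free_for x y a : (vbound a <= y)%N -> free_for x y a.
Proof.
elim: a => //= [a IHa b IHb|a IHa b IHb|a IHa b IHb|z a IH|z a IH].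
- by rewrite geq_max => /andP[/IHa -> /IHb ->].
- by rewrite geq_max => /andP[/IHa -> /IHb ->].
- by rewrite geq_max => /andP[/IHa -> /IHb ->].
- by rewrite geq_max => /andP[/ltn_eqF -> /IH ->]; rewrite orbT.
- by rewrite geq_max => /andP[/ltn_eqF -> /IH ->]; rewrite orbT.
Qed.

Lemma vbound_free_for_subst x y a :
  (vbound a <= y)%N -> free_for y x (subst x y a).
Proof.
elim: a => //= [a IHa b IHb|a IHa b IHb|a IHa b IHb|z a IH|z a IH].
- by rewrite geq_max => /andP[/IHa -> /IHb ->].
- by rewrite geq_max => /andP[/IHa -> /IHb ->].
- by rewrite geq_max => /andP[/IHa -> /IHb ->].
- rewrite geq_max => /andP[zy ay]; case: eqP => /= [_|/eqP ->].
    by rewrite (vbound_free ay) andbF.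
  by rewrite IH // orbT.
- rewrite geq_max => /andP[zy ay]; case: eqP => /= [_|/eqP ->].
    by rewrite (vbound_free ay) andbF.
  by rewrite IH // orbT.
Qed.

Lemma subst_notfree x y a : is_free x a = false -> subst x y a = a.
Proof.
elim: a => //= [n i xs|a IHa b IHb|a IHa b IHb|a IHa b IHb|z a IH|z a IH].
- move=> xxs; congr Atom; apply: val_inj => /=.
  rewrite -[RHS]map_id; apply/eq_in_map => z zxs.
  by case: eqP => // zx; rewrite -zx zxs in xxs.
- by move/norP=> [/negbTE/IHa -> /negbTE/IHb ->].
- by move/norP=> [/negbTE/IHa -> /negbTE/IHb ->].
- by move/norP=> [/negbTE/IHa -> /negbTE/IHb ->].
- by case: eqP => //= _ /IH ->.
- by case: eqP => //= _ /IH ->.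
Qed.

Lemma substK x y a : (vbound a <= y)%N -> subst y x (subst x y a) = a.
Proof.
elim: a => //= [n i xs|a IHa b IHb|a IHa b IHb|a IHa b IHb|z a IH|z a IH].
- move=> h; congr Atom; apply: val_inj => /=.
  rewrite -map_comp -[RHS]map_id; apply/eq_in_map => z zxs /=.
  case: (eqVneq z x) => [->|zx]; first by rewrite eqxx.
  case: eqP => // zy; have := @leq_bigmax_seq _ (tval xs) predT succn z zxs erefl.
  by rewrite zy leqNgt ltnS h.
- by rewrite geq_max => /andP[/IHa -> /IHb ->].
- by rewrite geq_max => /andP[/IHa -> /IHb ->].
- by rewrite geq_max => /andP[/IHa -> /IHb ->].
- rewrite geq_max => /andP[/ltn_eqF zy ay]; case: eqP => /= _; rewrite zy.
    by rewrite subst_notfree // vbound_free.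
  by rewrite IH.
- rewrite geq_max => /andP[/ltn_eqF zy ay]; case: eqP => /= _; rewrite zy.
    by rewrite subst_notfree // vbound_free.
  by rewrite IH.
Qed.

Lemma is_free_subst x y a : x != y -> is_free x (subst x y a) = false.
Proof.
move=> xy; elim: a => //= [n i xs|a -> b ->|a -> b ->|a -> b ->|z a IH|z a IH] //.
- apply/negP => /mapP[z _]; case: eqP => [_ /eqP|zx /esym//].
  by rewrite (negbTE xy).
- by case: eqP => [->|_] /=; [rewrite eqxx|rewrite IH andbF].
- by case: eqP => [->|_] /=; [rewrite eqxx|rewrite IH andbF].
Qed.

Lemma subst_id x a : subst x x a = a.
Proof.
elim: a => //= [n i xs|a -> b ->|a -> b ->|a -> b ->|z a ->|z a ->] //.
- congr Atom; apply: val_inj => /=; rewrite -[RHS]map_id.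
  by apply: eq_map => z; case: eqP.
- by case: eqP.
- by case: eqP.
Qed.

Lemma free_for_id x a : free_for x x a.
Proof.
elim: a => //= [a IHa b IHb|a IHa b IHb|a IHa b IHb|z a IH|z a IH].
- by rewrite IHa.
- by rewrite IHa.
- by rewrite IHa.
- by rewrite IH; case: (z == x) => //=; rewrite orbT.
- by rewrite IH; case: (z == x) => //=; rewrite orbT.
Qed.

(* Simultaneous renaming of the free variables, without renaming of bound
   variables; it is capture-free when [r] takes values outside the bound
   variables of [a]. *)
Fixpoint rename (r : nat -> nat) (a : formula) : formula :=
  match a with
  | Bot => Bot
  | Atom n i xs => Atom i (map_tuple r xs)
  | And a b => And (rename r a) (rename r b)
  | Or a b => Or (rename r a) (rename r b)
  | Imp a b => Imp (rename r a) (rename r b)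
  | Ex z a => Ex z (rename (update r z z) a)
  | All z a => All z (rename (update r z z) a)
  end.

Lemma update_same (D : Type) (r : nat -> D) x d e :
  update (update r x d) x e = update r x e.
Proof. by apply/funext => z; rewrite /update; case: eqP. Qed.

Lemma update_swap (D : Type) (r : nat -> D) x y d e : x != y ->
  update (update r x d) y e = update (update r y e) x d.
Proof.
move=> xy; apply/funext => z; rewrite /update.
by case: (eqVneq z y) => // ->; rewrite eq_sym (negbTE xy).
Qed.

Lemma rename_eq r s a :
  (forall z, is_free z a -> r z = s z) -> rename r a = rename s a.
Proof.
elim: a r s => //= [n i xs|a IHa b IHb|a IHa b IHb|a IHa b IHb|x a IH|x a IH] r s rs.
- by congr Atom; apply: val_inj; apply/eq_in_map => z /rs.
- by rewrite (IHa r s) ?(IHb r s) // => z h; apply: rs; rewrite h ?orbT.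
- by rewrite (IHa r s) ?(IHb r s) // => z h; apply: rs; rewrite h ?orbT.
- by rewrite (IHa r s) ?(IHb r s) // => z h; apply: rs; rewrite h ?orbT.
- congr Ex; apply: IH => z az; rewrite /update; case: (eqVneq z x) => // zx.
  by apply: rs; rewrite eq_sym zx.
- congr All; apply: IH => z az; rewrite /update; case: (eqVneq z x) => // zx.
  by apply: rs; rewrite eq_sym zx.
Qed.

Lemma update_id (D : Type) (r : nat -> D) x : update r x (r x) = r.
Proof. by apply/funext => z; rewrite /update; case: eqP => // ->. Qed.

Lemma rename_id a : rename id a = a.
Proof.
elim: a => //= [n i xs|a -> b ->|a -> b ->|a -> b ->|x a IH|x a IH] //.
- by congr Atom; apply: val_inj; rewrite /= map_id.
- by congr Ex; rewrite -[RHS]IH; congr rename; exact: (@update_id nat id x).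
- by congr All; rewrite -[RHS]IH; congr rename; exact: (@update_id nat id x).
Qed.

Lemma subst_rename N r x d a : (forall z, (N <= r z)%N \/ r z = z) -> (x < N)%N ->
  (vbound a <= N)%N ->
  subst x d (rename (update r x x) a) = rename (update r x d) a.
Proof.
move=> rN xN.
have rN' (s : nat -> nat) z : (forall z, (N <= s z)%N \/ s z = z) ->
    forall y, (N <= update s z z y)%N \/ update s z z y = y.
  by move=> sN y; rewrite /update; case: eqP => [->|_]; [right|exact: sN].
elim: a r rN => //= [n i xs|a IHa b IHb|a IHa b IHb|a IHa b IHb|z a IH|z a IH] r rN.
- move=> _; congr Atom; apply: val_inj => /=; rewrite -map_comp; apply: eq_map => z /=.
  rewrite /update; case: (eqVneq z x) => [_|zx]; first by rewrite eqxx.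
  case: eqP => // rx; case: (rN z) => [|rz].
    by rewrite rx leqNgt xN.
  by rewrite -rz rx eqxx in zx.
- by rewrite geq_max => /andP[aN bN]; rewrite IHa ?IHb.
- by rewrite geq_max => /andP[aN bN]; rewrite IHa ?IHb.
- by rewrite geq_max => /andP[aN bN]; rewrite IHa ?IHb.
- rewrite geq_max => /andP[_ aN]; case: eqP => [->|/eqP zx].
    by rewrite !update_same.
  rewrite update_swap 1?eq_sym // IH //; last exact: rN'.
  by rewrite update_swap.
- rewrite geq_max => /andP[_ aN]; case: eqP => [->|/eqP zx].
    by rewrite !update_same.
  rewrite update_swap 1?eq_sym // IH //; last exact: rN'.
  by rewrite update_swap.
Qed.

Lemma free_for_rename N r x d a : (vbound a <= N)%N -> (N <= d)%N ->
  free_for x d (rename r a).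
Proof.
move=> + Nd; elim: a r => //= [a IHa b IHb|a IHa b IHb|a IHa b IHb|z a IH|z a IH] r.
- by rewrite geq_max => /andP[aN bN]; rewrite IHa ?IHb.
- by rewrite geq_max => /andP[aN bN]; rewrite IHa ?IHb.
- by rewrite geq_max => /andP[aN bN]; rewrite IHa ?IHb.
- rewrite geq_max => /andP[zN aN]; rewrite IH // (ltn_eqF (leq_trans zN Nd)).
  by rewrite orbT.
- rewrite geq_max => /andP[zN aN]; rewrite IH // (ltn_eqF (leq_trans zN Nd)).
  by rewrite orbT.
Qed.

(** * Countability of the set of formulas *)

Fixpoint encode (a : formula) : GenTree.tree nat :=
  match a with
  | Bot => GenTree.Node 0 [::]
  | Atom n i xs =>
      GenTree.Node 1 [:: GenTree.Leaf i; GenTree.Node n [seq GenTree.Leaf x | x <- xs]]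
  | And a b => GenTree.Node 2 [:: encode a; encode b]
  | Or a b => GenTree.Node 3 [:: encode a; encode b]
  | Imp a b => GenTree.Node 4 [:: encode a; encode b]
  | Ex z a => GenTree.Node 5 [:: GenTree.Leaf z; encode a]
  | All z a => GenTree.Node 6 [:: GenTree.Leaf z; encode a]
  end.

Lemma encode_inj : injective encode.
Proof.
elim=> [|n i xs|a IHa b IHb|a IHa b IHb|a IHa b IHb|z a IH|z a IH]
       [|m j ys|c d|c d|c d|y c|y c] //=.
- move=> [-> nm]; move: ys; rewrite -nm => ys xy; congr Atom; apply: val_inj => /=.
  by move/inj_map: xy; apply => ? ? [].
- by move=> [/IHa -> /IHb ->].
- by move=> [/IHa -> /IHb ->].
- by move=> [/IHa -> /IHb ->].
- by move=> [-> /IH ->].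
- by move=> [-> /IH ->].
Qed.

Lemma formula_enum : exists e : nat -> formula, forall a, exists n, e n = a.
Proof.
have /choice[e eP] n : exists a, (exists b, pickle (encode b) = n) ->
    pickle (encode a) = n.
  have [[b bn]|nb] := pselect (exists b, pickle (encode b) = n); first by exists b.
  by exists Bot => /nb.
exists e => a; exists (pickle (encode a)).
by apply/encode_inj/(pcan_inj pickleK)/eP; exists a.
Qed.

(** An index codes a sequence whose first entry [m] is ignored by the enumeration. A code exceeds
    the entries of its sequence, so every triple recurs beyond any [m]. *)
Lemma formula_enum_often : exists e : nat -> formula * formula * formula,
  forall m t, exists2 n, (m <= n)%N & e n = t.
Proof.
have [e eP] := formula_enum.
exists (fun n => let s := CodeSeq.decode n in
  (e (nth 0 s 1), e (nth 0 s 2), e (nth 0 s 3))) => m [[a b] c].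
have [i ia] := eP a; have [j jb] := eP b; have [k kc] := eP c.
exists (CodeSeq.code [:: m; i; j; k]).
  by have /andP[/ltnW] := CodeSeq.ltn_code [:: m; i; j; k].
by rewrite CodeSeq.codeK /= ia jb kc.
Qed.

(** * Derivability *)

Section derivability.
Variable G : set formula.
Implicit Types t a b c : formula.

(** [t] is an antecedent and not a member of [G]: variables free in members of [G] may be
    generalized, which must not happen to those of [t]. *)
Definition entails t a := derivable G (Imp t a).

Lemma entails_derivable t a : derivable G a -> entails t a.
Proof. by move=> h; apply: der_mp h _; exact: der_K. Qed.

Lemma entails_mp t a b : entails t a -> entails t (Imp a b) -> entails t b.
Proof.
move=> ta tab; apply: der_mp ta _; apply: der_mp tab _; exact: der_S.
Qed.

Lemma entails_refl t : entails t t.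
Proof. by apply: (@entails_mp t (Imp t t)); exact: der_K. Qed.

Lemma entails_trans a b c : entails a b -> entails b c -> entails a c.
Proof.
by move=> ab bc; apply: entails_mp ab _; exact: entails_derivable.
Qed.

Lemma entails_andI t a b : entails t a -> entails t b -> entails t (And a b).
Proof.
move=> ta tb; apply: entails_mp tb _; apply: entails_mp ta _.
by apply: entails_derivable; exact: der_andI.
Qed.

Lemma entails_and t a b : entails (And t a) b <-> entails t (Imp a b).
Proof.
split=> h; last first.
  by apply: entails_mp (der_andE2 _ _ _) _; exact: entails_trans (der_andE1 _ _ _) h.
apply: entails_trans (der_andI _ t a) _.
have : derivable G (Imp (Imp a (Imp (And t a) b)) (Imp (Imp a (And t a)) (Imp a b))).
  exact: der_S.
by apply: der_mp; apply: entails_derivable.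
Qed.

Lemma entails_orE t a b c : entails t (Or a b) ->
  entails (And t a) c -> entails (And t b) c -> entails t c.
Proof.
move=> tab /entails_and ac /entails_and bc; apply: entails_mp tab _.
apply: entails_mp bc _; apply: entails_mp ac _.
by apply: entails_derivable; exact: der_orE.
Qed.

Lemma entails_botE t a : entails t Bot -> entails t a.
Proof. by move/entails_trans; apply; exact: der_botE. Qed.

(** Generalize over the fresh [y], then rename the bound variable back to [x]. *)
Lemma entails_allI t x y a : (vbound t <= y)%N -> (vbound (All x a) <= y)%N ->
  entails t (subst x y a) -> entails t (All x a).
Proof.
move=> ty; rewrite /= geq_max => /andP[xy ay] h.
apply: (@entails_trans _ (All y (subst x y a))).
  apply: der_mp (der_gen y h) _.
  by apply: der_allI; rewrite (vbound_free ty).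
apply: der_mp (_ : derivable G (All x (Imp (All y (subst x y a)) a))) _.
  apply: der_gen; rewrite -{2}(substK x ay).
  by apply: der_allE; exact: vbound_free_for_subst.
by apply: der_allI; rewrite /= is_free_subst ?andbF // (ltn_eqF xy).
Qed.

(** The bound variable is renamed to the fresh [y]; then [t] moves into the conclusion [Imp t c],
    since [der_exE] takes no side formula. *)
Lemma entails_exE t x y a c : (vbound t <= y)%N -> (vbound (Ex x a) <= y)%N ->
  (vbound c <= y)%N -> entails t (Ex x a) ->
  entails (And t (subst x y a)) c -> entails t c.
Proof.
move=> ty; rewrite /= geq_max => /andP[xy ay] cy ta h.
have {}ta : entails t (Ex y (subst x y a)).
  apply: entails_trans ta _.
  apply: der_mp (_ : derivable G (All x (Imp a (Ex y (subst x y a))))) _.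
    apply: der_gen; rewrite -{1}(substK x ay).
    by apply: der_exI; exact: vbound_free_for_subst.
  by apply: der_exE; rewrite /= is_free_subst ?andbF // (ltn_eqF xy).
have {}h : entails (subst x y a) (Imp t c).
  apply/entails_and; apply: entails_trans h; apply: entails_andI.
    exact: der_andE2.
  exact: der_andE1.
have {}h : entails (Ex y (subst x y a)) (Imp t c).
  apply: der_mp (der_gen y h) _; apply: der_exE => /=.
  by rewrite (vbound_free ty) (vbound_free cy).
exact: entails_mp (entails_refl t) (entails_trans ta h).
Qed.

Lemma derivable_all x a : derivable G (All x a) <-> derivable G a.
Proof.
split=> [h|]; last exact: der_gen.
by apply: der_mp h _; rewrite -{2}(subst_id x a); apply: der_allE; exact: free_for_id.
Qed.

End derivability.

(** * Universal closure over the variables below [N] *)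

Fixpoint close (N : nat) (a : formula) : formula :=
  if N is n.+1 then close n (All n a) else a.

Lemma derivable_close G N a : derivable G (close N a) <-> derivable G a.
Proof.
elim: N a => [|N IH] a //=.
by apply: (iff_trans (IH _)); exact: derivable_all.
Qed.

Lemma is_free_close N a z : is_free z (close N a) = is_free z a && (N <= z)%N.
Proof.
elim: N a => [|N IH] a /=; first by rewrite andbT.
by rewrite IH /= [RHS]andbC ltn_neqAle -andbA [X in _ && X]andbC andbA.
Qed.

Lemma vbound_close N M a :
  (N <= M)%N -> (vbound a <= M)%N -> (vbound (close N a) <= M)%N.
Proof.
elim: N a => [|N IH] a //= NM aM; apply: IH; first exact: ltnW.
by rewrite /= geq_max NM.
Qed.

(** The closure has no free variables, so its truth will not depend on the valuation. *)
Lemma rename_close N r a : (vbound a <= N)%N -> rename r (close N a) = close N a.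
Proof.
move=> aN; rewrite -[RHS]rename_id; apply: rename_eq => z.
by rewrite is_free_close => /andP[+ Nz]; rewrite vbound_free // (leq_trans aN).
Qed.

(** * Supports of sheaves *)

Definition countable_clopen_base (X : topologicalType) (B : nat -> set X) :=
  (forall n, clopen (B n)) /\
  (forall x A, nbhs x A -> exists2 n, B n x & B n `<=` A).

Section support.
Variable X : topologicalType.
Implicit Types F G : sheaf X.

Definition supp F : set X := range (@proj_sh _ F).

Lemma proj_sh_continuous F : continuous (@proj_sh _ F).
Proof.
move=> e; have [A [g [[oA Ae] _ cp _ _]]] := @proj_sh_lh _ F e.
by move: cp; rewrite continuous_open_subspace //; apply; exact: mem_set.
Qed.

Lemma supp_open F : open (supp F).
Proof.
rewrite openE => _ [e _ <-]; have [A [g [[oA Ae] opA _ _ _]]] := @proj_sh_lh _ F e.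
rewrite /interior nbhsE /=; exists (@proj_sh _ F @` A); last by move=> _ [a _ <-]; exists a.
by split=> //; exists e.
Qed.

Lemma supp_sheafification (P : presheaf X) : supp (sheafification P) =
  [set x | exists2 U : opens X, open_set U x & inhabited (psec P U)].
Proof.
apply/seteqP; split=> [_ [e _ <-]|x [U Ux [s]]].
  by have [U [s [Ux _]]] := etaleP e; exists U => //; exists.
by exists (germ s Ux).
Qed.

Lemma supp_empty : supp (sheaf_empty X) = set0.
Proof. by apply/seteqP; split=> // _ [[]]. Qed.

Lemma supp_coprod (I : choiceType) (F : I -> sheaf X) :
  supp (sheaf_coprod F) = \bigcup_i supp (F i).
Proof.
apply/seteqP; split=> [_ [[i e] _ <-]|_ [i _ [e _ <-]]].
  by exists i => //; exists e.
by exists (existT _ i e).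
Qed.

(** There is one section over [U] if [U] lies in [O] and none otherwise. This makes every open set
    the support of a sheaf. *)
Definition chi_presheaf (O : set X) : presheaf X.
Proof.
refine (@Presheaf X (fun U => U `<=` O) (fun U V VU UO => subset_trans VU UO) _ _).
- by move=> *; exact: Prop_irrelevance.
- by move=> *; exact: Prop_irrelevance.
Defined.

Lemma supp_chi (O : set X) :
  open O -> supp (sheafification (chi_presheaf O)) = O.
Proof.
move=> oO; rewrite supp_sheafification; apply/seteqP; split=> x /=.
  by move=> [U Ux [UO]]; exact: UO.
by move=> Ox; exists (Opens oO) => //; exists.
Qed.

Lemma sections_supp F (U : set X) : sections F U -> U `<=` supp F.
Proof. by move=> s x Ux; exists (s (exist _ x (mem_set Ux))) => //; rewrite sec_proj. Qed.

Variable B : nat -> set X.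
Hypothesis baseB : countable_clopen_base B.

(* The least-index rule turns a cover by basic clopen sets into a disjoint one,
   on which arbitrarily chosen local sections glue. *)
Lemma section_over F (U : set X) :
  open U -> U `<=` supp F -> inhabited (sections F U).
Proof.
move=> oU UF; have [B_clopen B_base] := baseB.
(* An empty [U] is treated apart, because the default value [e0] below needs a point of [F]. *)
have [[x0 Ux0]|nU] := pselect (U !=set0); last first.
  unshelve refine (inhabits (@Sections _ F U
    (fun x => False_rect _ (nU (ex_intro _ (val x) (set_valP x)))) _ _)).
  - by move=> x; case: (nU); exists (val x); exact: set_valP.
  - by move=> x; case: (nU); exists (val x); exact: set_valP.
have [e0 _ _] := UF _ Ux0.
pose good n (g : X -> F) :=
  forall x, B n x -> {for x, continuous g} /\ proj_sh (g x) = x.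
have /choice[g gP] n : exists g, (exists g, good n g) -> good n g.
  have [[g gn]|] := pselect (exists g, good n g); first by exists g.
  by exists (fun=> e0).
have covU x : U x -> exists n, `[< good n (g n) /\ B n x >].
  move=> Ux; have [e _ ex] := UF _ Ux.
  have [A [h [[oA Ae] opA _ ch hK]]] := @proj_sh_lh _ F e.
  have [|n Bx BA] := B_base x (@proj_sh _ F @` A).
    by apply: open_nbhs_nbhs; split=> //; exists e.
  exists n; apply/asboolP; split=> //; apply: gP; exists h => y /BA Ay.
  rewrite continuous_open_subspace // in ch; split.
    by apply: ch; exact: mem_set.
  by have [a Aa <-] := Ay; rewrite hK.
pose nn x := if pselect (U x) is left Ux then ex_minn (covU x Ux) else 0.
have nnE x (Ux : U x) n : good n (g n) -> B n x ->
    (forall m, (m < n)%N -> good m (g m) -> ~ B m x) -> nn x = n.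
  move=> gn Bn nB; rewrite /nn; case: pselect => // Ux'.
  case: ex_minnP => m /asboolP[gm Bm] /(_ n); rewrite asboolT // => /(_ isT) mn.
  by apply/eqP; rewrite eqn_leq mn leqNgt; apply/negP => /nB /(_ gm).
have nnP x : U x -> [/\ good (nn x) (g (nn x)), B (nn x) x &
    forall m, (m < nn x)%N -> good m (g m) -> ~ B m x].
  move=> Ux; rewrite /nn; case: pselect => // Ux'.
  case: ex_minnP => m /asboolP[gm Bm] min; split=> // k km gk Bk.
  by have := min k; rewrite asboolT // => /(_ isT); rewrite leqNgt km.
(* Only finitely many earlier basic sets have to be avoided, and their complements are open; hence
   the least index is locally constant. *)
have near_out x k : (forall m, (m < k)%N -> good m (g m) -> ~ B m x) ->
    \forall y \near x, forall m, (m < k)%N -> good m (g m) -> ~ B m y.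
  elim: k => [|k IH] h; first by apply: filterE.
  have hk : \forall y \near x, good k (g k) -> ~ B k y.
    have [gk|ngk] := pselect (good k (g k)); last by apply: filterE.
    have : open (~` B k) by rewrite openC; exact: (B_clopen k).2.
    rewrite openE => /(_ x (h k (ltnSn k) gk)) nx.
    by apply: filterS nx.
  have {}IH := IH (fun m mk => h m (ltnW mk)).
  apply: filterS2 IH hk => y hy1 hy2 m; rewrite ltnS leq_eqVlt => /orP[/eqP ->//|].
  exact: hy1.
pose h x := g (nn x) x.
have h_cont x : U x -> {for x, continuous h}.
  move=> Ux; have [gx Bx minx] := nnP _ Ux.
  have nearE : {near x, g (nn x) =1 h}.
    have nU : nbhs x U by apply: open_nbhs_nbhs.
    have nB : nbhs x (B (nn x)).
      by apply: open_nbhs_nbhs; split=> //; exact: (B_clopen _).1.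
    apply: filterS3 nU nB (near_out _ _ minx) => y Uy By miny.
    by rewrite /h (@nnE y Uy (nn x)).
  rewrite /prop_for /continuous_at /h.
  apply: cvg_trans (gx x Bx).1.
  apply: near_eq_cvg; apply: filterS nearE => y ->//.
unshelve refine (inhabits (@Sections _ F U (fun x => h (set_val x)) _ _)).
- move=> x; apply: (@continuous_comp U X F set_val h).
    exact: initial_continuous.
  by apply: h_cont; exact: set_valP.
- by move=> x; have [gx Bx _] := nnP _ (set_valP x); have [] := gx _ Bx.
Qed.

Lemma has_global_sectionE F : has_global_section F <-> supp F = setT.
Proof.
split=> [[s]|sF]; first by apply/seteqP; split=> //; exact: sections_supp.
by apply: section_over; [exact: openT|rewrite sF].
Qed.

(** Over an open set inside all the supports, [section_over] gives a section of every factor on that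
    same open set, however many factors there are. *)
Lemma supp_prod (I : choiceType) (F : I -> sheaf X) :
  supp (sheaf_prod F) = interior (\bigcap_i supp (F i)).
Proof.
rewrite supp_sheafification; apply/seteqP; split=> x /=.
  move=> [U Ux [s]]; rewrite /interior nbhsE /=; exists U.
    by split=> //; exact: open_setP.
  by move=> y Uy i _; exact: (sections_supp (s i)).
rewrite /interior nbhsE => -[U [oU Ux] UF]; exists (Opens oU) => //.
constructor=> i; apply: inhabited_witness.
by apply: section_over => // y /UF; apply.
Qed.

(** A morphism over [U] is obtained by projecting [F] to the base and applying a section of [G] over
    the part of [U] that supports [F]. *)
Lemma supp_hom F G : supp (sheaf_hom F G) = interior (~` supp F `|` supp G).
Proof.
rewrite supp_sheafification; apply/seteqP; split=> x /=.
  move=> [U Ux [f]]; rewrite /interior nbhsE /=; exists U.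
    by split=> //; exact: open_setP.
  move=> y Uy; have [[e _ ey]|] := pselect (supp F y); last by left.
  right; rewrite -ey in Uy *.
  by exists (f (exist _ e (mem_set Uy))) => //; rewrite mor_proj.
rewrite /interior nbhsE => -[U [oU Ux] UFG]; exists (Opens oU) => //=.
have [s] : inhabited (sections G (U `&` supp F)).
  apply: section_over; first exact: openI oU (supp_open F).
  by move=> y [/UFG[|]].
have W (e : @proj_sh _ F @^-1` U) : (U `&` supp F) (proj_sh (set_val e)).
  by split; [exact: (set_valP e)|exists (set_val e)].
pose q e : set_type (U `&` supp F) := SigSub (mem_set (W e)).
unshelve refine (inhabits (@Morphisms _ F G U (fun e => s (q e)) _ _)).
- move=> e; apply: (@continuous_comp _ _ _ q s); last exact: sec_continuous.
  apply: continuous_comp_initial => {}e.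
  apply: (@continuous_comp _ _ _ set_val (@proj_sh _ F)).
    exact: initial_continuous.
  exact: proj_sh_continuous.
- by move=> e; rewrite sec_proj.
Qed.

End support.

(** * Continuous families of prime theories *)

(* The parameters are the variables [d + N]. In [omit_imp] a universal formula
   [c] must even have a refuted instance, because [All] is interpreted by the
   interior of the intersection of the instances. *)
Record generic_family (X : topologicalType) (G : set formula) (N : nat)
    (D : X -> set formula) : Prop := GenericFamily {
  generic_open : forall a, open [set x | D x a];
  generic_derivable : forall x a, derivable G a -> D x a;
  generic_mp : forall x a b, D x a -> D x (Imp a b) -> D x b;
  generic_bot : forall x, ~ D x Bot;
  generic_or : forall x a b, D x (Or a b) -> D x a \/ D x b;
  generic_ex : forall x z a, D x (Ex z a) -> exists d, D x (subst z (d + N) a);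
  omit_imp : forall x a c W, ~ D x (Imp a c) -> nbhs x W ->
    exists q, [/\ W q, D q a, ~ D q c & forall z b, c = All z b ->
      exists d, ~ D q (subst z (d + N) b)] }.

Lemma ex_bound4 (i j k l : nat) :
  exists y, [/\ i <= y, j <= y, k <= y & l <= y]%N.
Proof.
by exists (maxn (maxn i j) (maxn k l)); rewrite !leq_max !leqnn !orbT.
Qed.

Section generic.
Variables (X : topologicalType) (B : nat -> set X) (G : set formula) (N : nat).
Hypothesis baseB : countable_clopen_base B.
Hypothesis perfect : forall (x : X) W, nbhs x W ->
  exists2 y, W y & exists2 V, nbhs x V & ~ V y.

Local Notation entails := (entails G).

(** * One-step extensions of a finite theory *)

Definition witness (t f : formula) : Prop :=
  match f with
  | Or a b => entails t a \/ entails t b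
  | Ex z a => exists d, entails t (subst z (d + N) a)
  | _ => True
  end.

(** If both disjuncts made [c] derivable, [t] would already entail [c]; for an existential formula a
    fresh parameter serves as the witness. *)
Lemma entails_witness t c f : ~ entails t c ->
  exists t', [/\ entails t' t, ~ entails t' c & entails t f -> witness t' f].
Proof.
move=> tc; have [tf|ntf] := pselect (entails t f); last first.
  by exists t; split=> //; exact: entails_refl.
case: f tf => [|n i xs|a b|a b|a b|z a|z a] tf;
  try by exists t; split=> //; exact: entails_refl.
- have [tac|tac] := pselect (entails (And t a) c).
    exists (And t b); split; first exact: der_andE1.
      by move=> tbc; apply: tc; exact: entails_orE tf tac tbc.
    by right; exact: der_andE2.
  exists (And t a); split=> //; first exact: der_andE1.
  by left; exact: der_andE2.
- have [y [ty ay cy Ny]] := ex_bound4 (vbound t) (vbound (Ex z a)) (vbound c) N.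
  exists (And t (subst z y a)); split; first exact: der_andE1.
    by move=> h; apply: tc; exact: entails_exE ty ay cy tf h.
  by exists (y - N)%N; rewrite subnK //; exact: der_andE2.
Qed.

(** A universal [c] is replaced by its instance at a fresh parameter. As [c] entails [c'], omitting
    [c'] omits [c] as well. *)
Lemma omit_instance t c : ~ entails t c ->
  exists c', [/\ ~ entails t c', entails c c' &
    forall z b, c = All z b -> exists d, c' = subst z (d + N) b].
Proof.
move=> tc; case: c tc => [|n i xs|a b|a b|a b|z a|z a] tc;
  try by eexists; split; [exact: tc|exact: entails_refl|].
have [y [ty ay Ny _]] := ex_bound4 (vbound t) (vbound (All z a)) N 0.
exists (subst z y a); split.
- by move=> h; apply: tc; exact: entails_allI ty ay h.
- apply: der_allE; apply: vbound_free_for; apply: leq_trans ay.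
  by rewrite /= leq_maxr.
- by move=> _ _ [<- <-]; exists (y - N)%N; rewrite subnK.
Qed.

(* The points of [sV] share the finite approximation [sth] of their theory;
   at the distinguished point [spt] the formula [sC] will be omitted. *)
Record state := State { sV : set X; spt : X; sth : formula; sC : formula }.

Definition wf s := [/\ open (sV s), sV s (spt s) & ~ entails (sth s) (sC s)].

(** Perfectness leaves part of the piece outside some clopen neighbourhood of the distinguished
    point. The choice depends on the state alone, so all points of a piece get the same split. *)
Lemma ex_split : exists K : state -> set X, forall s, wf s ->
  [/\ clopen (K s), K s (spt s) & exists2 y, sV s y & ~ K s y].
Proof.
suff /choice[K KP] s : exists K, wf s -> [/\ clopen K, K (spt s) &
    exists2 y, sV s y & ~ K y] by exists K.
have [[oV Vp _]|] := pselect (wf s); last by exists set0.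
have [|y Vy [V nV nVy]] := @perfect (spt s) (sV s); first exact: open_nbhs_nbhs.
have [n Bp BV] := baseB.2 _ _ nV; exists (B n) => _; split=> //.
  exact: baseB.1.
by exists y => // /BV.
Qed.

Lemma ex_keep : exists k : formula -> formula -> formula -> formula,
  forall t c f, ~ entails t c ->
  [/\ entails (k t c f) t, ~ entails (k t c f) c & entails t f -> witness (k t c f) f].
Proof.
have /choice[k kP] (p : formula * formula * formula) : exists t',
    ~ entails p.1.1 p.1.2 -> [/\ entails t' p.1.1, ~ entails t' p.1.2 &
      entails p.1.1 p.2 -> witness t' p.2].
  have [h|h] := pselect (entails p.1.1 p.1.2); first by exists Bot.
  by have [t' ?] := entails_witness p.2 h; exists t'.
by exists (fun t c f => k (t, c, f)) => t c f; exact: kP (t, c, f).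
Qed.

Lemma ex_omit : exists o : formula -> formula -> formula,
  forall t c, ~ entails t c ->
  [/\ ~ entails t (o t c), entails c (o t c) &
    forall z b, c = All z b -> exists d, o t c = subst z (d + N) b].
Proof.
have /choice[o oP] (p : formula * formula) : exists c',
    ~ entails p.1 p.2 -> [/\ ~ entails p.1 c', entails p.2 c' &
    forall z b, p.2 = All z b -> exists d, c' = subst z (d + N) b].
  have [h|h] := pselect (entails p.1 p.2); first by exists Bot.
  by have [c' ?] := omit_instance h; exists c'.
by exists (fun t c => o (t, c)) => t c; exact: oP (t, c).
Qed.

(** * The refinement step *)

Definition side (A : set X) (x : X) : set X := if `[< A x >] then A else ~` A.

Lemma side_refl A x : side A x x.
Proof. by rewrite /side; case: asboolP. Qed.

Lemma side_eq A x y : side A x y -> side A y = side A x /\ `[< A y >] = `[< A x >].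
Proof.
by rewrite /side; case: (asboolP (A x)) => Ax; case: (asboolP (A y)).
Qed.

Lemma side_open A x : clopen A -> open (side A x).
Proof. by move=> [oA cA]; rewrite /side; case: asboolP => // _; rewrite openC. Qed.

Variables (K : state -> set X) (keep : formula -> formula -> formula -> formula)
  (omit : formula -> formula -> formula)
  (e : nat -> formula * formula * formula).
Hypothesis KP : forall s, wf s ->
  [/\ clopen (K s), K s (spt s) & exists2 y, sV s y & ~ K s y].
Hypothesis keepP : forall t c f, ~ entails t c ->
  [/\ entails (keep t c f) t, ~ entails (keep t c f) c &
      entails t f -> witness (keep t c f) f].
Hypothesis omitP : forall t c, ~ entails t c ->
  [/\ ~ entails t (omit t c), entails c (omit t c) &
      forall z b, c = All z b -> exists d, omit t c = subst z (d + N) b].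
Hypothesis eP : forall m t, exists2 n, (m <= n)%N & e n = t.

(** Cutting along [B n] at stage [n] makes the pieces around a point eventually enter each of its
    neighbourhoods. *)
Definition next_set n s x := sV s `&` side (K s) x `&` side (B n) x.

Definition next_pt n s x :=
  if `[< next_set n s x (spt s) >] then spt s else xget (spt s) (next_set n s x).

(* Off [K s] the family branches: if possible, the new piece forces [a] and
   its distinguished point omits [c]. *)
Definition next_goal n s x : formula * formula :=
  let: (a, c, f) := e n in
  if `[< ~ K s x /\ ~ entails (And (sth s) a) c >] then
    (And (sth s) a, omit (And (sth s) a) c)
  else (sth s, sC s).

Definition next n s x :=
  let: (t, c) := next_goal n s x in
  State (next_set n s x) (next_pt n s x) (keep t c (e n).2) c.

Lemma next_goalP n s x : wf s ->
  ~ entails (next_goal n s x).1 (next_goal n s x).2 /\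
  entails (next_goal n s x).1 (sth s).
Proof.
move=> [_ _ sC]; rewrite /next_goal; case: (e n) => [[a c] f].
case: asboolP => /= [[_ /omitP[]]|_]; last by split=> //; exact: entails_refl.
by split=> //; exact: der_andE1.
Qed.

Lemma sV_next n s x : sV (next n s x) = next_set n s x.
Proof. by rewrite /next; case: next_goal. Qed.

Lemma next_set_refl n s x : sV s x -> next_set n s x x.
Proof. by split; [split=> //|]; exact: side_refl. Qed.

(** The new state depends on [x] only through the sides of [K s] and [B n] on which [x] lies. *)
Lemma next_eq n s x y : sV (next n s x) y -> next n s y = next n s x.
Proof.
rewrite sV_next => -[[Vy /side_eq[sK Kxy]] /side_eq[sB _]].
have nV : next_set n s y = next_set n s x by rewrite /next_set sK sB.
have nG : next_goal n s y = next_goal n s x.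
  rewrite /next_goal; case: (e n) => [[a c] f].
  by rewrite !asbool_and !asbool_neg Kxy.
by rewrite /next nG /next_pt nV.
Qed.

Lemma next_wf n s x : wf s -> sV s x -> wf (next n s x).
Proof.
move=> ws Vx; have [ng _] := next_goalP n x ws; have [oV _ _] := ws.
have [cK _ _] := KP ws.
have oN : open (next_set n s x).
  apply: openI; first by apply: openI => //; exact: side_open.
  by apply: side_open; exact: baseB.1.
have Np : next_set n s x (next_pt n s x).
  rewrite /next_pt; case: asboolP => // _.
  by apply: xgetPex; exists x; exact: next_set_refl.
move: ng; rewrite /next; case: next_goal => t c /= tc; split=> //=.
by have [] := keepP (e n).2 tc.
Qed.

Lemma next_th n s x : wf s -> entails (sth (next n s x)) (sth s).
Proof.
move=> ws; have [] := next_goalP n x ws; rewrite /next; case: next_goal => t c /= tc.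
by apply: entails_trans; have [] := keepP (e n).2 tc.
Qed.

Lemma next_witness n s x : wf s -> entails (sth s) (e n).2 ->
  witness (sth (next n s x)) (e n).2.
Proof.
move=> ws sf; have [] := next_goalP n x ws; rewrite /next; case: next_goal => t c /= tc ts.
by have [_ _] := keepP (e n).2 tc; apply; exact: entails_trans sf.
Qed.

(** The distinguished point lies in [K s], where no branching occurs, so its goal is never
    replaced. *)
Lemma next_center n s : wf s ->
  spt (next n s (spt s)) = spt s /\ sC (next n s (spt s)) = sC s.
Proof.
move=> ws; have [_ Vp _] := ws; have [_ Kp _] := KP ws.
rewrite /next /next_goal; case: (e n) => [[a c] f] /=.
rewrite asboolF; last by case.
by split=> //=; rewrite /next_pt asboolT //; exact: next_set_refl.
Qed.

Lemma next_branch n s : wf s -> ~ entails (sth s) (Imp (e n).1.1 (e n).1.2) ->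
  exists q, [/\ sV s q, spt (next n s q) = q,
    entails (sth (next n s q)) (e n).1.1,
    entails (e n).1.2 (sC (next n s q)) &
    forall z b, (e n).1.2 = All z b ->
      exists d, sC (next n s q) = subst z (d + N) b].
Proof.
move=> ws; have [_ _ [y Vy nKy]] := KP ws.
have wn := next_wf n ws Vy.
pose q := spt (next n s y).
(* The point [y] off [K s] only serves to reach the new piece; [q] is the distinguished point of
   that piece and shares its state. *)
have nq : next n s q = next n s y by apply: next_eq; have [] := wn.
have Vq : sV s q by have [_ + _] := wn; rewrite sV_next => -[[]].
move=> nac; exists q; rewrite nq; split=> //; move: nac;
  rewrite /next /next_goal; case: (e n) => [[a c] f] /= nac.
all: have {}nac : ~ entails (And (sth s) a) c by move/entails_and.
all: rewrite asboolT //=; have [nt co cA] := omitP nac => //.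
have [h _ _] := keepP f nt.
by apply: entails_trans h _; exact: der_andE2.
Qed.

(** * The limit theories of the points *)

Variable s0 : state.
Hypotheses (wf0 : wf s0) (V0 : sV s0 = setT).

Fixpoint st n x := if n is m.+1 then next m (st m x) x else s0.

Lemma stP n x :
  [/\ wf (st n x), sV (st n x) x & forall y, sV (st n x) y -> st n y = st n x].
Proof.
elim: n x => [|n IH] x /=; first by rewrite V0.
have [ws Vx sE] := IH x; split; first exact: next_wf.
  by rewrite sV_next; exact: next_set_refl.
move=> y Vy; rewrite (sE y) ?(next_eq Vy) //.
by move: Vy; rewrite sV_next => -[[]].
Qed.

Lemma st_th n m x : (n <= m)%N -> entails (sth (st m x)) (sth (st n x)).
Proof.
elim: m => [|m IH]; first by rewrite leqn0 => /eqP ->; exact: entails_refl.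
rewrite leq_eqVlt ltnS => /orP[/eqP ->|/IH h]; first exact: entails_refl.
by apply: entails_trans h; apply: next_th; have [] := stP m x.
Qed.

Lemma st_sub n m x : (n <= m)%N -> sV (st m x) `<=` sV (st n x).
Proof.
elim: m => [|m IH]; first by rewrite leqn0 => /eqP ->.
rewrite leq_eqVlt ltnS => /orP[/eqP ->//|/IH h].
by apply: subset_trans h => y /=; rewrite sV_next => -[[]].
Qed.

Lemma st_center n m x : spt (st n x) = x -> (n <= m)%N ->
  spt (st m x) = x /\ sC (st m x) = sC (st n x).
Proof.
move=> px; elim: m => [|m IH]; first by rewrite leqn0 => /eqP <-.
rewrite leq_eqVlt ltnS => /orP[/eqP <-//|/IH[pm cm]] /=.
have [ws _ _] := stP m x.
by have := next_center m ws; rewrite pm cm.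
Qed.

Definition theory (x : X) : set formula := [set a | exists n, entails (sth (st n x)) a].

Lemma theory_mono x a b : entails a b -> theory x a -> theory x b.
Proof. by move=> ab [n h]; exists n; exact: entails_trans ab. Qed.

(** A derivation of the goal at some stage would persist to a later stage at which [x] is still
    distinguished with the same goal, against well-formedness. *)
Lemma theory_omit n x : spt (st n x) = x -> ~ theory x (sC (st n x)).
Proof.
move=> px [m h]; have [_ cm] := st_center px (leq_maxl n m).
have [[_ _]] := stP (maxn n m) x; rewrite cm; case.
by apply: entails_trans h; apply: st_th; exact: leq_maxr.
Qed.

Lemma theory_generic : generic_family G N theory.
Proof.
(* Every request recurs at some stage past [m], and [f] is still entailed there because the
   approximations only grow stronger. *)
have eW x m f : entails (sth (st m x)) f -> exists n, witness (sth (st n x)) f.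
  move=> h; have [n mn en] := eP m (Bot, Bot, f); exists n.+1 => /=.
  have := @next_witness n (st n x) x; rewrite en; apply; first by have [] := stP n x.
  by apply: entails_trans h; exact: st_th.
split.
- move=> a; rewrite openE => x [n h]; rewrite /interior nbhsE /=.
  have [[oV _ _] Vx sE] := stP n x.
  by exists (sV (st n x)) => // y /sE sy; exists n; rewrite sy.
- by move=> x a h; exists 0; exact: entails_derivable.
- move=> x a b [n ha] [m hb]; exists (maxn n m); apply: (@entails_mp _ _ a).
    by apply: entails_trans ha; apply: st_th; exact: leq_maxl.
  by apply: entails_trans hb; apply: st_th; exact: leq_maxr.
- move=> x [n h]; have [[_ _ nc] _ _] := stP n x; apply: nc; exact: entails_botE.
- by move=> x a b [m /eW[n [h|h]]]; [left|right]; exists n.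
- by move=> x z a [m /eW[n [d h]]]; exists d, n.
- move=> x a c W nac /baseB.2[k Bx BW].
  (* Past stage [k] the piece of [x] has been cut along [B k], so the branch point [q] falls inside
     [W]. *)
  have [n kn en] := eP k.+1 (a, c, Bot).
  have [ws Vx sE] := stP n x.
  have := @next_branch n _ ws; rewrite en /= => -[|q [Vq pq qa cq cA]].
    by move=> h; apply: nac; exists n.
  have sq := sE _ Vq; rewrite -sq in pq qa cq cA.
  have om := @theory_omit n.+1 q pq.
  exists q; split.
  + apply: BW; have := @st_sub k.+1 n x kn q Vq; rewrite /= sV_next => -[_].
    by rewrite /side asboolT.
  + by exists n.+1.
  + by move=> h; apply: om; exact: theory_mono cq h.
  + by move=> z b /cA[d cd]; exists d; rewrite -cd.
Qed.

End generic.

Lemma ex_generic_family (X : topologicalType) (B : nat -> set X)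
    (G : set formula) (N : nat) (x0 : X) (c : formula) :
  countable_clopen_base B ->
  (forall (x : X) W, nbhs x W -> exists2 y, W y & exists2 V, nbhs x V & ~ V y) ->
  ~ derivable G c ->
  exists2 D, @generic_family X G N D & ~ D x0 c.
Proof.
move=> baseB perfect nc.
have [K KP] := ex_split G baseB perfect.
have [keep keepP] := ex_keep G N.
have [omit omitP] := ex_omit G N.
have [e eP] := formula_enum_often.
(* The process starts from the whole space, a trivially derivable formula, and the goal [c] to be
   omitted at [x0]. *)
pose s0 := State setT x0 (Imp Bot Bot) c.
have wf0 : wf G s0.
  split=> //=; first exact: openT.
  by move=> h; apply: nc; apply: der_mp h; exact: entails_refl.
exists (theory B G K keep omit e s0).
  exact: theory_generic.
exact: (@theory_omit X B G N baseB K keep omit e KP keepP omitP s0 wf0 erefl 0 x0).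
Qed.

(** * Truth in the structure of a generic family *)

Section truth.
Variables (X : topologicalType) (B : nat -> set X) (G : set formula) (N : nat).
Variable D : X -> set formula.
Hypothesis baseB : countable_clopen_base B.
Hypothesis genD : generic_family G N D.

Definition generic_structure : sheaf_structure X nat := fun n i ds =>
  sheafification (chi_presheaf [set x | D x (Atom i (map_tuple (addn^~ N) ds))]).

Let D_entails x a b : derivable G (Imp a b) -> D x a -> D x b.
Proof. by move=> ab xa; apply: (generic_mp genD xa); exact: (generic_derivable genD). Qed.

(** Truth lemma, by induction on [a]: the individual [d] acts as the parameter [d + N]. Truth sets
    are open, so one inclusion into an interior is pointwise; the other, for [Imp] and [All], comes
    from [omit_imp]. *)
Lemma supp_interp a mu : (vbound a <= N)%N ->
  supp (interp generic_structure a mu) = [set x | D x (rename (fun z => mu z + N)%N a)].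
Proof.
have shiftE m z d : (fun y => update m z d y + N)%N =
    update (fun y => m y + N)%N z (d + N)%N.
  by apply/funext => y; rewrite /update; case: ifP.
have sub_int (b : formula) (A : set X) : [set x | D x b] `<=` A ->
    [set x | D x b] `<=` interior A.
  by move=> bA; rewrite -open_subsetE //; exact: (generic_open genD).
have inst m z d b : (z < N)%N -> (vbound b <= N)%N ->
    subst z (d + N) (rename (update (fun y => m y + N) z z) b) =
    rename (fun y => update m z d y + N)%N b.
  move=> zN bN; rewrite shiftE; apply: subst_rename zN bN => y.
  by left; exact: leq_addl.
elim: a mu => [|n i xs|a IHa b IHb|a IHa b IHb|a IHa b IHb|z a IH|z a IH] mu /=;
  rewrite ?geq_max.
- by move=> _; rewrite supp_empty; apply/seteqP; split=> // x /(generic_bot genD).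
- move=> _; rewrite supp_chi; last exact: (generic_open genD).
  suff -> : map_tuple (addn^~ N) (map_tuple mu xs) = map_tuple (fun z => mu z + N)%N xs.
    by [].
  by apply: val_inj; rewrite /= -map_comp.
- move=> /andP[/(IHa mu) sa /(IHb mu) sb]; rewrite (supp_prod baseB).
  apply/seteqP; split=> [x /interior_subset h|].
    have := h true I; have := h false I; rewrite /sheaf_pair sa sb /= => xb xa.
    apply: (generic_mp genD xb); apply: (generic_mp genD xa).
    by apply: (generic_derivable genD); exact: der_andI.
  apply: sub_int => x h [] _; rewrite /sheaf_pair ?sa ?sb /=.
    by apply: D_entails h; exact: der_andE1.
  by apply: D_entails h; exact: der_andE2.
- move=> /andP[/(IHa mu) sa /(IHb mu) sb]; rewrite supp_coprod.
  apply/seteqP; split=> [x [[] _]|x /(generic_or genD)[h|h]].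
  + by rewrite /sheaf_pair sa => h; apply: D_entails h; exact: der_orI1.
  + by rewrite /sheaf_pair sb => h; apply: D_entails h; exact: der_orI2.
  + by exists true => //; rewrite /sheaf_pair sa.
  + by exists false => //; rewrite /sheaf_pair sb.
- move=> /andP[/(IHa mu) sa /(IHb mu) sb]; rewrite (supp_hom baseB) sa sb.
  apply/seteqP; split=> [x h|].
    apply: contrapT => nab; have [q [Wq qa nqb _]] := omit_imp genD nab h.
    by case: Wq.
  apply: sub_int => x h /=.
  have [xa|] := pselect (D x (rename (fun z => mu z + N)%N a)); last by left.
  by right; exact: (generic_mp genD xa).
- move=> /andP[zN aN]; rewrite supp_coprod.
  apply/seteqP; split=> [x [d _]|x /(generic_ex genD)[d]].
    rewrite IH //= -inst // => h; apply: D_entails h; apply: der_exI.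
    by apply: free_for_rename aN _; exact: leq_addl.
  by rewrite inst // => h; exists d => //; rewrite IH.
- move=> /andP[zN aN]; rewrite (supp_prod baseB).
  apply/seteqP; split=> [x h|].
    apply: contrapT => nall.
    (* A trivial antecedent turns the omitted universal formula into an implication, so [omit_imp]
       yields a nearby point where an instance fails. *)
    have nimp : ~ D x (Imp (Imp Bot Bot) (All z (rename (update (fun y => mu y + N) z z) a))).
      move=> k; apply: nall; apply: (generic_mp genD _ k).
      by apply: (generic_derivable genD); exact: entails_refl.
    have [q [Wq _ _ /(_ _ _ erefl)[d]]] := omit_imp genD nimp h; apply.
    by have := Wq d I; rewrite IH //= inst.
  apply: sub_int => x h d _; rewrite IH //= -inst //.
  apply: D_entails h; apply: der_allE.
  by apply: free_for_rename aN _; exact: leq_addl.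
Qed.

End truth.

(** * Countermodels to underivable formulas *)

Lemma valid_close (X : topologicalType) (B : nat -> set X) (D : choiceType)
    (M : sheaf_structure X D) N a :
  countable_clopen_base B -> valid M (close N a) <-> valid M a.
Proof.
move=> baseB; elim: N a => [|N IH] a //=; apply: (iff_trans (IH _)).
split=> h mu; apply/(has_global_sectionE baseB).
  have := (has_global_sectionE baseB _).1 (h mu).
  rewrite /= (supp_prod baseB) => sT; apply/seteqP; split=> // x _.
  have /interior_subset/(_ (mu N) I) : interior (\bigcap_d
      supp (interp M a (update mu N d))) x by rewrite sT.
  by rewrite update_id.
rewrite /= (supp_prod baseB) (_ : \bigcap_d _ = setT) ?interiorT //.
apply/seteqP; split=> // x _ d _.
by rewrite ((has_global_sectionE baseB _).1 (h (update mu N d))).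
Qed.

(** In the generic structure the closures of the hypotheses belong to every theory, hence have full
    support, while the closure of [psi] fails at [x0]. *)
Lemma completeness (X : topologicalType) (B : nat -> set X) (x0 : X)
    (G : set formula) (N : nat) (psi : formula) :
  countable_clopen_base B ->
  (forall (x : X) W, nbhs x W -> exists2 y, W y & exists2 V, nbhs x V & ~ V y) ->
  (forall a, G a -> (vbound a <= N)%N) -> (vbound psi <= N)%N ->
  (forall M : sheaf_structure X nat, (forall a, G a -> valid M a) -> valid M psi) ->
  derivable G psi.
Proof.
move=> baseB perfect GN psiN psiV; apply: contrapT => npsi.
have ncl : ~ derivable G (close N psi) by rewrite derivable_close.
have [D genD nD] := ex_generic_family N x0 baseB perfect ncl.
have supp_close a mu : (vbound a <= N)%N ->
    supp (interp (generic_structure N D) (close N a) mu) = [set x | D x (close N a)].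
  by move=> aN; rewrite (supp_interp baseB genD) ?rename_close //; exact: vbound_close.
have : valid (generic_structure N D) (close N psi).
  apply/(valid_close _ _ _ baseB); apply: psiV => a Ga.
  apply/(valid_close _ N _ baseB) => mu; apply/(has_global_sectionE baseB).
  rewrite supp_close; last exact: GN.
  apply/seteqP; split=> // x _; apply: (generic_derivable genD).
  by apply/derivable_close; exact: der_hyp.
move=> /(_ id)/(has_global_sectionE baseB); rewrite supp_close // => sT.
by apply: nD; have : setT x0 by []; rewrite -sT.
Qed.

(** * The spaces *)

Lemma baire_near_mkseq (f : baire_space) n :
  \forall g \near f, mkseq g n = mkseq f n.
Proof.
elim: n => [|n IH]; first by apply: filterE.
have fn : \forall g \near f, g n = f n.
  apply: (@proj_continuous _ (fun _ : nat => nat : topologicalType) n f [set f n]).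
  by apply: open_nbhs_nbhs; split=> //; exact: discrete_open.
by apply: filterS2 IH fn => g; rewrite /mkseq -addn1 !iotaD !map_cat => -> /= ->.
Qed.

Definition cylinder (s : seq nat) : set baire_space := [set f | mkseq f (size s) = s].

Lemma cylinder_base : countable_clopen_base (cylinder \o CodeSeq.decode).
Proof.
have oC n (P : set (seq nat)) : open [set f : baire_space | P (mkseq f n)].
  rewrite openE => f Pf; apply: filterS (baire_near_mkseq f n) => g gf.
  by rewrite /= gf.
split=> [n|f A]; first split.
- exact: (oC _ [set t | t = _]).
- by rewrite -openC; exact: (oC _ (~` [set t | t = _])).
(* The filter of cylinders around [f] converges to [f] in each coordinate, hence in the product. *)
pose F := filter_from setT (fun n => [set g : baire_space | mkseq g n = mkseq f n]).
have FF : Filter F.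
  apply: filter_from_filter; first by exists 0.
  move=> i j _ _; exists (maxn i j) => // g gf.
  have tk k : (k <= maxn i j)%N -> mkseq g k = mkseq f k.
    move=> kij; have := congr1 (take k) gf.
    by rewrite /mkseq -!map_take take_iota (minn_idPl kij).
  by split; apply: tk; [exact: leq_maxl|exact: leq_maxr].
have : F --> f.
  apply/cvg_sup => i U [V] [[W] oW <-] Wf WU.
  exists i.+1 => // g gf; apply: WU => /=; have := congr1 (nth 0 ^~ i) gf.
  by rewrite !nth_mkseq // => ->.
move=> /[apply] -[n _ nA]; exists (CodeSeq.code (mkseq f n)).
  by rewrite /= CodeSeq.codeK /cylinder /= size_mkseq.
by move=> g; rewrite /= CodeSeq.codeK /cylinder /= size_mkseq => /nA.
Qed.

Lemma baire_perfect (f : baire_space) W : nbhs f W ->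
  exists2 g, W g & exists2 V, nbhs f V & ~ V g.
Proof.
move=> /cylinder_base.2[n]; rewrite /= /cylinder /=; set s := CodeSeq.decode n.
(* This point follows [f] along the prefix defining the cylinder and differs from it at index
   [size s]. *)
move=> fs sW; exists (fun i => if (i < size s)%N then f i else (f i).+1).
  apply: sW; rewrite /= -[RHS]fs; apply/eq_in_map => i.
  by rewrite mem_iota add0n => /andP[_ ->].
exists [set g | mkseq g (size s).+1 = mkseq f (size s).+1].
  exact: baire_near_mkseq.
move=> /(congr1 (nth 0 ^~ (size s))); rewrite !nth_mkseq // ltnn => /eqP.
by rewrite gtn_eqF.
Qed.

Section metrizable_spaces.
Import Order.TTheory GRing.Theory Num.Theory.
Local Open Scope ring_scope.
Variables (R : realType) (X : topologicalType).
Hypothesis metX : metrizable R X.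

Lemma metrizable_perfect (x : X) W : isolated [set: X] = set0 -> nbhs x W ->
  exists2 y, W y & exists2 V, nbhs x V & ~ V y.
Proof.
have [d [d0 dE dC dT dN]] := metX => iso nW; apply: contrapT => noy.
suff : isolated [set: X] x by rewrite iso.
split; first exact: mem_set; exists W => //; rewrite setIT.
apply/seteqP; split=> [y Wy|_ ->]; last exact: nbhs_singleton.
apply: contrapT => yx; apply: noy; exists y => //.
(* The open ball about [x] of radius [d x y] separates [x] from [y]. *)
exists [set z | d x z < d x y]; last by rewrite /= ltxx.
apply/dN; exists (d x y) => //; rewrite lt_neqAle d0 andbT eq_sym.
by apply/eqP => /dE xy; apply: yx.
Qed.

(** For each centre in a countable dense set and each pair of radii, one clopen set between the two
    balls is chosen, if there is one. A small clopen set around [x] fits between two balls about a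
    nearby centre, so these choices form a base. *)
Lemma metrizable_base : separable X -> clopen_base X ->
  exists B : nat -> set X, countable_clopen_base B.
Proof.
have [d [d0 dE dC dT dN]] := metX.
move=> [A /countable_injP[f finj] dA] [_ base].
pose r (k : nat) : R := k.+1%:R^-1.
have r_gt0 k : 0 < r k by rewrite invr_gt0 ltr0n.
have ex_r (e : R) : 0 < e -> exists k, r k < e.
  by move=> /ltr_add_invr[k]; rewrite add0r; exists k.
pose b x e : set X := [set y | d x y < e].
have nb x e : 0 < e -> nbhs x (b x e) by move=> e0; apply/dN; exists e.
(* The ball of radius [r l] about the point with code [n] is contained in
   [K (n, k, l)], which lies in its ball of radius [r k]. *)
pose P (p : nat * nat * nat) (K : set X) := clopen K /\ exists a,
  [/\ A a, f a = p.1.1, b a (r p.2) `<=` K & K `<=` b a (r p.1.2)].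
have /choice[K KP] p : exists K, clopen K /\ ((exists K, P p K) -> P p K).
  have [[K PK]|nP] := pselect (exists K, P p K).
    by exists K; split=> //; case: PK.
  by exists set0; split=> [|/nP//]; split; [exact: open0|exact: closed0].
pose B m := let s := CodeSeq.decode m in K (nth 0%N s 0, nth 0%N s 1, nth 0%N s 2).
exists B; split=> [m|x O /dN[e e0 eO]]; first exact: (KP _).1.
have [k rk] : exists k, r k < e / 2 by apply: ex_r; rewrite divr_gt0.
have [U [cU Ux] Ub] : filter_from [set U | clopen U /\ U x] id (b x (r k / 2)).
  by apply: base; apply: nb; rewrite divr_gt0.
have [e' e'0 e'U] : exists2 e', 0 < e' & b x e' `<=` U.
  by apply/dN; apply: open_nbhs_nbhs; split=> //; case: cU.
(* The bound [e' / 2] puts the inner ball about [a] inside [U]; the bound [r k / 2] puts [U] inside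
   the outer ball about [a]. *)
have [l rl] : exists l, r l < Num.min (e' / 2) (r k / 2).
  by apply: ex_r; rewrite lt_min !divr_gt0.
move: rl; rewrite lt_min => /andP[rl rlk].
have [a [xa Aa]] : (interior (b x (r l)) `&` A) !=set0.
  apply: dA; last exact: open_interior.
  by exists x; apply: nb.
have {}xa : d x a < r l by exact: (interior_subset xa).
have [_ /(_ _)[]] := KP (f a, k, l).
  exists U; split=> //; exists a; split=> //= y.
    move=> /= ay; apply: e'U => /=; apply: le_lt_trans (dT x a y) _.
    by rewrite [ltRHS]splitr ltrD // (lt_trans _ rl).
  move=> /Ub /= xy; apply: le_lt_trans (dT a x y) _.
  by rewrite [ltRHS]splitr ltrD // dC (lt_trans _ rlk).
move=> _ [a' [Aa' /= fa aK Ka]].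
have aa : a' = a by apply: finj fa; exact: mem_set.
subst a'; exists (CodeSeq.code [:: f a; k; l]); rewrite /B CodeSeq.codeK /=.
  by apply: aK; rewrite /= /b /= dC.
move=> y /Ka /= ay; apply: eO => /=; apply: le_lt_trans (dT x a y) _.
rewrite [ltRHS]splitr ltrD // ?(lt_trans ay) //.
by apply: lt_trans xa _; apply: lt_trans rlk _; apply: lt_trans rk;
  rewrite ltr_pdivrMr // ltr_pMr // ltr1n.
Qed.

End metrizable_spaces.

(** * Completeness over the Baire space and over the space [X] *)

Theorem theorem6p18 :
  (forall (k : nat) (phi : 'I_k -> formula) (psi : formula),
     (forall (D : countType) (M : sheaf_structure baire_space D),
        inhabited D -> (forall i, valid M (phi i)) -> valid M psi) ->
     derivable (range phi) psi)
  /\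
  (forall (R : realType) (X : topologicalType),
     [set: X] !=set0 -> clopen_base X -> separable X -> metrizable R X ->
     isolated [set: X] = set0 ->
     forall psi : formula,
     (forall (D : countType) (M : sheaf_structure X D),
        inhabited D -> valid M psi) ->
     derivable set0 psi).
Proof.
split=> [k phi psi psiV|R X [x0 _] clX sepX metX isoX psi psiV].
  (* Finitely many hypotheses have a common bound on their variables, above which the parameters
     start. *)
  pose N := maxn (vbound psi) (\max_(i < k) vbound (phi i)).
  apply: (@completeness baire_space _ (fun=> 0) (range phi) N psi cylinder_base).
  - exact: baire_perfect.
  - by move=> _ [i _ <-]; rewrite /N leq_max (leq_bigmax i) orbT.
  - exact: leq_maxl.
  - move=> M MG; apply: psiV; first by exists; exact: 0.
    by move=> i; apply: MG; exists i.
have [B baseB] := metrizable_base metX sepX clX.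
apply: (completeness x0 baseB _ _ (leqnn (vbound psi))) => //.
- by move=> x W; apply: (metrizable_perfect metX isoX).
- by move=> M _; apply: psiV; exists; exact: 0.
Qed.
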